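(* Let $R\in\mathbb N_+$ satisfy $\min_{1\le i\le d} n_i\ge R^2>\max_{1\le j\le d} r_j$ and $\min_{1\le j\le d} r_j\ge R$. Then for any $\tau\in S_d$ and any four distinct indices $i_1,i_2,i_3,i_4\in\{1,\dots,d\}$, there is a Lebesgue-measure-zero set $\mathcal N\subset\mathcal U^d_{\vec r,\vec n,\tau}$ such that for every $\vec{\mathbf u}\in\mathcal U^d_{\vec r,\vec n,\tau}\setminus\mathcal N$, the output of the Four-Index Algorithm, run with the integer $R$ on $i_1,i_2,i_3,i_4$ and with exact access to the entries of $\mathbf T=\varphi(\vec{\mathbf u},\tau)$, is of the correct order with respect to $\tau$.
   Context: **Tensor ring format.** $d$ is a positive integer, $S_d$ is the group of permutations of $\{1,\dots,d\}$, and $\vec n=(n_1,\dots,n_d)$, $\vec r=(r_1,\dots,r_d)$ are vectors of positive integers. Arguments of $\tau$ and subscripts of $r$ are read modulo $d$ (so $\tau(d+1)=\tau(1)$, $r_{d+1}=r_1$). For $\tau\in S_d$ let $\mathcal U^d_{\vec r,\vec n,\tau}=\bigoplus_{i=1}^d\mathbb R^{r_{\tau^{-1}(i)}\times n_i\times r_{\tau^{-1}(i)+1}}$, a Euclidean space with Lebesgue measure. For $\vec{\mathbf u}=(\mathbf u^{[1]},\dots,\mathbf u^{[d]})$ in it, write $\mathbf u^{[i]}(x)=\mathbf u^{[i]}(:,x,:)\in\mathbb R^{r_{\tau^{-1}(i)}\times r_{\tau^{-1}(i)+1}}$. The tensor $\varphi(\vec{\mathbf u},\tau)\in\mathbb R^{n_1\times\cdots\times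 n_d}$ has entries $$\varphi(\vec{\mathbf u},\tau)(x_1,\dots,x_d)=\mathrm{tr}\big(\mathbf u^{[\tau(1)]}(x_{\tau(1)})\,\mathbf u^{[\tau(2)]}(x_{\tau(2)})\cdots\mathbf u^{[\tau(d)]}(x_{\tau(d)})\big).$$ **Correct order.** For distinct $i_1,i_2,i_3,i_4\in\{1,\dots,d\}$, the tuple $(i_1,i_2,i_3,i_4)$ is of the correct order with respect to $\tau$ if there is $s\in\{1,2,3,4\}$ with $\tau^{-1}(i_s)<\tau^{-1}(i_{s+1})<\tau^{-1}(i_{s+2})<\tau^{-1}(i_{s+3})$ or $\tau^{-1}(i_s)>\tau^{-1}(i_{s+1})>\tau^{-1}(i_{s+2})>\tau^{-1}(i_{s+3})$, the subscripts of $i$ being read modulo 4. **Matricizations.** Given distinct $i_1,\dots,i_4$ and fixed $y_i\in\{1,\dots,n_i\}$ for $i\notin\{i_1,\dots,i_4\}$, let $A(x_{i_1},x_{i_2},x_{i_3},x_{i_4})$ be the entry of the tensor whose $i_s$-th coordinate is $x_{i_s}$ ($1\le s\le4$) and whose $i$-th coordinate is $y_i$ for all other $i$. Define $M_{(i_1,i_2),(i_3,i_4)}\in\mathbb R^{(n_{i_1}n_{i_2})\times(n_{i_3}n_{i_4})}$, $M_{(i_1,i_3),(i_2,i_4)}\in\mathbb R^{(n_{i_1}n_{i_3})\times(n_{i_2}n_{i_4})}$, $M_{(i_1,i_4),(i_2,i_3)}\in\mathbb R^{(n_{i_1}n_{i_4})\times(n_{i_2}n_{i_3})}$ by $M_{(i_1,i_2),(i_3,i_4)}((x_{i_1},x_{i_2}),(x_{i_3},x_{i_4}))=M_{(i_1,i_3),(i_2,i_4)}((x_{i_1},x_{i_3}),(x_{i_2},x_{i_4}))=M_{(i_1,i_4),(i_2,i_3)}((x_{i_1},x_{i_4}),(x_{i_2},x_{i_3}))=A(x_{i_1},x_{i_2},x_{i_3},x_{i_4})$.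 $\sigma_k(M)$ denotes the $k$-th largest singular value of $M$. **Four-Index Algorithm.** Input: $i_1,i_2,i_3,i_4$, an integer $R\in\mathbb N_+$, and an oracle for the entries of $\mathbf T$. Sample (i.e. pick arbitrarily) $y_i\in\{1,\dots,n_i\}$ for $i\notin\{i_1,\dots,i_4\}$; form the three matrices above from $\mathbf T$. Compare $a=\sigma_{R^4}(M_{(i_1,i_2),(i_3,i_4)})$, $b=\sigma_{R^4}(M_{(i_1,i_3),(i_2,i_4)})$, $c=\sigma_{R^4}(M_{(i_1,i_4),(i_2,i_3)})$. If $a>\max\{b,c\}$ return $(i_1,i_3,i_2,i_4)$; if $b>\max\{a,c\}$ return $(i_1,i_2,i_3,i_4)$; if $c>\max\{a,b\}$ return $(i_1,i_2,i_4,i_3)$. *)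

(* Defs.v *)
From HB Require Import structures.
From mathcomp Require Import all_boot all_order all_algebra all_fingroup.
From mathcomp.real_closed Require Import complex mxtens.
From mathcomp Require Import all_classical all_reals all_analysis.

Set Implicit Arguments.
Unset Strict Implicit.
Unset Printing Implicit Defensive.

Import Order.TTheory GRing.Theory Num.Theory.

Local Open Scope classical_set_scope.
Local Open Scope ring_scope.

(* The library has no Lebesgue measure on R^m. It is built here on m-tuples
   (which carry the sigma-algebra generated by the coordinates, i.e. the Borel
   one) as the m-fold product of the one-dimensional Lebesgue measure, moved
   along the bijection R * R^m -> R^(m+1) at each step. *)
Section LebesgueTuple.
Variable R : realType.

Definition cons_pair m (p : R * m.-tuple R) : m.+1.-tuple R :=
  [tuple of p.1 :: p.2].

Definition uncons_pair m (t : m.+1.-tuple R) : R * m.-tuple R :=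
  (thead t, [tuple of behead t]).

Lemma cons_pairK m : cancel (@cons_pair m) (@uncons_pair m).
Proof. by case=> x t; congr (_, _); apply: val_inj. Qed.

Lemma measurable_cons_pair m : measurable_fun setT (@cons_pair m).
Proof.
by apply: measurable_cons; [exact: measurable_fst|exact: measurable_snd].
Qed.

Lemma measurable_uncons_pair m : measurable_fun setT (@uncons_pair m).
Proof.
by apply: measurable_fun_pair; [exact: measurable_tnth|exact: measurable_behead].
Qed.

Section Step.
Variables (m : nat) (mu : {sigma_finite_measure set (m.-tuple R) -> \bar R}).

Definition lebesgue_step : set (m.+1.-tuple R) -> \bar R :=
  pushforward (@lebesgue_measure R \x mu)%E (@cons_pair m).

Let step0 : lebesgue_step set0 = 0%E.
Proof. by rewrite /lebesgue_step /pushforward preimage_set0 measure0. Qed.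

Let step_ge0 A : (0 <= lebesgue_step A)%E.
Proof. by rewrite /lebesgue_step /pushforward; exact: measure_ge0. Qed.

Let step_sigma_additive : semi_sigma_additive lebesgue_step.
Proof.
have mf := @measurable_cons_pair m.
move=> F mF tF mUF; rewrite /lebesgue_step /pushforward preimage_bigcup.
apply: measure_semi_sigma_additive.
- by move=> k; rewrite -[X in measurable X]setTI; exact: mf.
- apply/trivIsetP => /= i j _ _ ij; rewrite -preimage_setI.
  by move/trivIsetP : tF => /(_ _ _ _ _ ij) ->//; rewrite preimage_set0.
- by rewrite -preimage_bigcup -[X in measurable X]setTI; exact: mf.
Qed.

HB.instance Definition _ := isMeasure.Build _ _ _
  lebesgue_step step0 step_ge0 step_sigma_additive.

Let step_sigma_finite : sigma_finite setT lebesgue_step.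
Proof.
have /sigma_finiteP[F [FT ndF F_fin]] := sigma_finiteT (@lebesgue_measure R).
have /sigma_finiteP[G [GT ndG G_fin]] := sigma_finiteT mu.
exists (fun k => @uncons_pair m @^-1` (F k `*` G k)).
  rewrite -preimage_bigcup (_ : \bigcup_k _ = setT) ?preimage_setT//.
  apply/seteqP; split=> // -[x t] _.
  have [i _ Fix] : (\bigcup_k F k) x by rewrite -FT.
  have [j _ Gjt] : (\bigcup_k G k) t by rewrite -GT.
  exists (maxn i j) => //; split=> /=.
  - by move: x Fix; exact/subsetPset/ndF/leq_maxl.
  - by move: t Gjt; exact/subsetPset/ndG/leq_maxr.
move=> k; have [? ?] := F_fin k; have [? ?] := G_fin k; split.
  by rewrite -[X in measurable X]setTI; apply: measurable_uncons_pair => //;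
     exact: measurableX.
rewrite /lebesgue_step /pushforward -comp_preimage.
rewrite (_ : _ \o _ = id); last by apply/funext => p; exact: cons_pairK.
by rewrite preimage_id product_measure1E// lte_mul_pinfty// ge0_fin_numE.
Qed.

HB.instance Definition _ := Measure_isSigmaFinite.Build _ _ _
  lebesgue_step step_sigma_finite.

End Step.

Fixpoint lebesgue_tuple m : {sigma_finite_measure set (m.-tuple R) -> \bar R} :=
  if m is m'.+1 then lebesgue_step (lebesgue_tuple m') else \d_[tuple].

Lemma lebesgue_tuple_box m (A : 'I_m -> set (measurableTypeR R)) : (forall i, measurable (A i)) ->
  lebesgue_tuple m [set t | forall i, A i (tnth t i)] =
  (\prod_(i < m) @lebesgue_measure R (A i))%E.
Proof.
elim: m => [|m IH] in A *.
  move=> _; rewrite big_ord0/= diracE mem_set//; by case.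
move=> mA; rewrite big_ord_recl -IH// -product_measure1E//; last first.
  have -> : [set t : m.-tuple R | forall i, A (lift ord0 i) (tnth t i)] =
    \bigcap_(i in [set: 'I_m]) ((@tnth _ _ ^~ i) @^-1` A (lift ord0 i)).
    by apply/seteqP; split=> t /= h i; [move=> _; exact: h|exact: h].
  apply: fin_bigcap_measurable; first exact: finite_finset.
  move=> i _; rewrite -[X in measurable X]setTI.
  exact: (@measurable_tnth _ (measurableTypeR R) m i measurableT _ (mA _)).
rewrite [LHS]/= /lebesgue_step /pushforward.
congr (product_measure1 _ _ _); apply/seteqP; split=> -[x t] /=.
  move=> h; split; first exact: (h ord0).
  by move=> i; have := h (lift ord0 i); rewrite tnthS.
by move=> -[h0 h] i; case: (unliftP ord0 i) => [j ->|->]//; rewrite tnthS.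
Qed.

End LebesgueTuple.

Section TensorRing.
Variables (R : realType) (d : nat).
Implicit Types (r n : 'I_d -> nat) (tau : 'S_d).

(* Index sets {1, ..., k} are rendered as 'I_k, and j + 1 modulo d as ordS j. *)
Definition ring_cores r n tau : Type :=
  forall i : 'I_d, 'I_(n i) -> 'M[R]_(r (tau^-1 i)%g, r (ordS (tau^-1 i)%g)).

Definition ring_coord r n tau : finType :=
  {i : 'I_d & 'I_(r (tau^-1 i)%g) * 'I_(n i) * 'I_(r (ordS (tau^-1 i)%g))}%type.

Definition ring_flatten r n tau (u : ring_cores r n tau) :
    #|ring_coord r n tau|.-tuple R :=
  [tuple (let c := enum_val k in
          u (tag c) (tagged c).1.2 (tagged c).1.1 (tagged c).2)
   | k < #|ring_coord r n tau|].

Definition ring_null r n tau (N : set (ring_cores r n tau)) : Prop :=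
  (lebesgue_tuple R #|ring_coord r n tau|).-negligible
    (@ring_flatten r n tau @` N).

Definition tensor n : Type := (forall i : 'I_d, 'I_(n i)) -> R.

Section Product.
Variables (r : 'I_d -> nat) (B : forall k : 'I_d, 'M[R]_(r k, r (ordS k))).

(* B j *m B (j + 1) *m ... *m B (j + m - 1), indices modulo d *)
Fixpoint ring_mulmx (j : 'I_d) m : 'M[R]_(r j, r (iter m (@ordS d) j)) :=
  if m is m'.+1 then ring_mulmx j m' *m B (iter m' (@ordS d) j) else 1%:M.

End Product.

Lemma iter_ordS (j : 'I_d) : iter d (@ordS d) j = j.
Proof.
have d_gt0 : (0 < d)%N by apply: leq_ltn_trans (ltn_ord j).
apply: val_inj => /=.
have H m : iter m (@ordS d) j = ((j + m) %% d)%N :> nat.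
  elim: m => [|m IH] /=; first by rewrite addn0 modn_small.
  by rewrite IH -addn1 modnDml addn1 addnS.
by rewrite H modnDr modn_small.
Qed.

Definition ring_tensor (d_gt0 : (0 < d)%N) r n tau (u : ring_cores r n tau) :
    tensor n :=
  fun x =>
    let B k : 'M[R]_(r k, r (ordS k)) :=
      castmx (congr1 r (permK tau k), congr1 (r \o @ordS d) (permK tau k))
        (u (tau k) (x (tau k))) in
    let j0 := Ordinal d_gt0 in
    \tr (castmx (erefl, congr1 r (iter_ordS j0)) (ring_mulmx B j0 d)).

Definition correct_order tau (q : 4.-tuple 'I_d) : Prop :=
  exists s : 'I_4,
    let p k : nat := (tau^-1)%g (tnth q (iter k (@ordS 4) s)) in
    [/\ p 0 < p 1, p 1 < p 2 & p 2 < p 3]%N \/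
    [/\ p 0 > p 1, p 1 > p 2 & p 2 > p 3]%N.

End TensorRing.

Section SingularValues.
Variable R : realType.

(* Square roots of the eigenvalues of A^T A, with multiplicity and in
   nonincreasing order; spectral_diag requires an algebraically closed field
   and gives the eigenvalues of a normal matrix. For an m x n matrix with m < n
   the list has n - m extra zeros at the end. *)
Definition singular_values m n (A : 'M[R]_(m, n)) : seq R :=
  let G : 'M[R[i]]_n := map_mx (real_complex R) (A^T *m A) in
  sort >=%O [seq Num.sqrt (complex.Re (spectral_diag G 0 k)) | k : 'I_n].

(* k-th largest singular value, counting from k = 1 *)
Definition sigma_ k m n (A : 'M[R]_(m, n)) : R := (singular_values A)`_k.-1.

Lemma gram_normalmx m n (A : 'M[R]_(m, n)) :
  map_mx (real_complex R) (A^T *m A) \is normalmx.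
Proof.
have GT : (A^T *m A)^T = A^T *m A by rewrite trmx_mul trmxK.
move: (A^T *m A) GT => G GT.
have E : map_mx Num.conj (map_mx (real_complex R) G)^T = map_mx (real_complex R) G.
  rewrite -{2}GT; apply/matrixP => i j; rewrite !mxE.
  by apply/CrealP/complex_realP; exists (G j i).
by apply/normalmxP; rewrite E.
Qed.

End SingularValues.

Section FourIndex.
Variables (R : realType) (d : nat) (n : 'I_d -> nat).

Section Slice.
Variables (T : tensor R n) (i1 i2 i3 i4 : 'I_d) (y : forall i, 'I_(n i)).

(* The values of y at i1, ..., i4 are overwritten. *)
Definition slice (x1 : 'I_(n i1)) (x2 : 'I_(n i2)) (x3 : 'I_(n i3))
    (x4 : 'I_(n i4)) : R :=
  T (dfwith (dfwith (dfwith (dfwith y i1 x1) i2 x2) i3 x3) i4 x4).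

(* mxtens_unindex : 'I_(a * b) -> 'I_a * 'I_b is the lexicographic bijection. *)
Definition mat12_34 : 'M[R]_(n i1 * n i2, n i3 * n i4) :=
  \matrix_(p, q) slice (mxtens_unindex p).1 (mxtens_unindex p).2
                       (mxtens_unindex q).1 (mxtens_unindex q).2.

Definition mat13_24 : 'M[R]_(n i1 * n i3, n i2 * n i4) :=
  \matrix_(p, q) slice (mxtens_unindex p).1 (mxtens_unindex q).1
                       (mxtens_unindex p).2 (mxtens_unindex q).2.

Definition mat14_23 : 'M[R]_(n i1 * n i4, n i2 * n i3) :=
  \matrix_(p, q) slice (mxtens_unindex p).1 (mxtens_unindex q).1
                       (mxtens_unindex q).2 (mxtens_unindex p).2.

End Slice.

(* None: no strict maximum, in which case nothing is returned. *)
Definition four_index_algorithm (i1 i2 i3 i4 : 'I_d) (K : nat)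
    (y : forall i, 'I_(n i)) (T : tensor R n) : option (4.-tuple 'I_d) :=
  let a := sigma_ (K ^ 4) (mat12_34 T i1 i2 i3 i4 y) in
  let b := sigma_ (K ^ 4) (mat13_24 T i1 i2 i3 i4 y) in
  let c := sigma_ (K ^ 4) (mat14_23 T i1 i2 i3 i4 y) in
  if Num.max b c < a then Some [tuple i1; i3; i2; i4]
  else if Num.max a c < b then Some [tuple i1; i2; i3; i4]
  else if Num.max a b < c then Some [tuple i1; i2; i4; i3]
  else None.

End FourIndex.

(* Main.v *)
Require Import Defs.
From mathcomp Require Import all_boot all_order all_algebra all_fingroup.
From mathcomp.real_closed Require Import complex mxtens.
From mathcomp Require Import all_classical all_reals all_analysis.
From mathcomp Require Import finmap measurable_realfun zify.

(** The order of four sites on a ring, up to rotation and reversal, is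
    determined by which of the three ways of splitting them into two pairs is
    interlaced around the ring, and the algorithm detects the interlaced
    splitting through the ranks of the three matricizations.

    - If the splitting is not interlaced, one pair lies in an arc of the ring
      that avoids the other pair.  Cutting the two bonds that bound this arc
      writes the tensor as tr(A B), where the matrix A depends on the sites in
      the arc only and B on the other sites only.  All bond dimensions are at
      most K^2 - 1, so the matricization is a sum of (K^2 - 1)^2 rank one
      terms; its rank is below K^4 for every choice of the cores
      ([mxrank_separated], [noncrossing_rank]).

    - If it is interlaced, some cores give rank at least K^4.  Number the
      first K^2 slices of each of the four sites by pairs (a, b) and let slice
      (a, b) be the elementary matrix E_ab; let all slices of the other sites
      be the identity of size K.  An entry is then the trace of a product of
      four elementary matrices, that is 1 when consecutive subscripts agree
      around the ring and 0 otherwise.  With interlaced pairs, the subscripts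
      of one pair determine those of the other, so a K^4 x K^4 submatrix is
      the identity ([crossing_minor]).  The same submatrix has for general
      cores a determinant that is a polynomial in the entries of the cores.
      This polynomial is not zero, hence vanishes only on a null set
      ([polynomial_zeros_null]), and there are finitely many choices of the
      fixed coordinates y ([crossing_generic_rank]).

    Finally sigma_k(A) > 0 if and only if k <= rank A ([sigma_gt0]), so outside
    the null set the interlaced splitting is the only one of the three with a
    positive K^4-th singular value.  The bond dimensions vary along the ring;
    to write the tensor as the trace of a product of square matrices of one
    size, the slices are padded with zeros ([ring_tensorE]). *)

Set Implicit Arguments.
Unset Strict Implicit.
Unset Printing Implicit Defensive.

Import Order.TTheory GRing.Theory Num.Theory.

Local Open Scope classical_set_scope.
Local Open Scope ring_scope.
Local Open Scope sesquilinear_scope.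

(** * Singular values and rank *)

Lemma mulmx_tr_eq0 (R : realDomainType) n (v : 'rV[R]_n) :
  v *m v^T = 0 -> v = 0.
Proof.
move=> /matrixP/(_ 0 0); rewrite !mxE.
under eq_bigr do rewrite mxE -expr2.
move=> /eqP; rewrite psumr_eq0 => [/allP h|i _]; last exact: sqr_ge0.
apply/rowP => j; rewrite mxE.
by have := h j (mem_index_enum j); rewrite sqrf_eq0 => /eqP.
Qed.

(** A and A A^T have the same left kernel: if v A A^T = 0 then the sum of the
    squares of the entries of v A is 0. *)
Lemma mxrank_mulmx_tr (R : realFieldType) m n (A : 'M[R]_(m, n)) :
  \rank (A *m A^T) = \rank A.
Proof.
have sub : (kermx (A *m A^T) <= kermx A)%MS.
  apply/rV_subP => v /sub_kermxP vAA; apply/sub_kermxP/mulmx_tr_eq0.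
  by rewrite trmx_mul mulmxA -(mulmxA v) vAA mul0mx.
apply/eqP; rewrite eqn_leq mxrankM_maxl /=.
have := mxrankS sub; rewrite !mxrank_ker => h.
by have := rank_leq_row A; have := rank_leq_row (A *m A^T); lia.
Qed.

Lemma mxrank_gram (R : realFieldType) m n (A : 'M[R]_(m, n)) :
  \rank (A^T *m A) = \rank A.
Proof. by have := mxrank_mulmx_tr A^T; rewrite trmxK mxrank_tr. Qed.

Lemma mxrank_mxsub (F : fieldType) m n m' n' (f : 'I_m' -> 'I_m)
  (g : 'I_n' -> 'I_n) (A : 'M[F]_(m, n)) : (\rank (mxsub f g A) <= \rank A)%N.
Proof.
have -> : mxsub f g A = rowsub f 1%:M *m A *m colsub g 1%:M.
  apply/matrixP => i j; rewrite !mxE (bigD1 (g j)) //= !mxE eqxx mulr1.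
  rewrite (bigD1 (f i)) //= !mxE eqxx mul1r !big1 ?addr0 // => k nk.
    by rewrite [X in _ * X]mxE [X in _ * X]mxE (negPf nk) mulr0.
  by rewrite !mxE eq_sym (negPf nk) mul0r.
by apply: leq_trans (mxrankM_maxl _ _) (mxrankM_maxr _ _).
Qed.

(** The rows and columns with a nonzero diagonal entry cut out an invertible
    submatrix, through which the whole matrix factors. *)
Lemma mxrank_diag (F : fieldType) n (D : 'rV[F]_n) :
  \rank (diag_mx D) = #|[pred k | D 0 k != 0]|.
Proof.
set S := [pred k | _]; pose f (l : 'I_#|S|) := enum_val l.
have fE k : k \in S -> exists l, f l = k.
  by move=> kS; exists (enum_rank_in kS k); exact: enum_rankK_in.
have finj : injective f by exact: enum_val_inj.
apply/eqP; rewrite eqn_leq; apply/andP; split.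
  have -> : diag_mx D = colsub f 1%:M *m rowsub f (diag_mx D).
    apply/matrixP => i j; rewrite [RHS]mxE.
    have [/fE[l <-]|] := boolP (i \in S).
      rewrite (bigD1 l) //= big1 ?addr0; first by rewrite !mxE eqxx mul1r.
      by move=> k nk; rewrite !mxE (inj_eq finj) eq_sym (negPf nk) mul0r.
    rewrite inE negbK => /eqP Di; rewrite mxE Di mul0rn big1 // => k _.
    rewrite mxE [1%:M _ _]mxE; case: eqP => [ifk|_]; last by rewrite mul0r.
    by have := enum_valP k; rewrite -/(f k) -ifk inE Di eqxx.
  by apply: leq_trans (mxrankM_maxl _ _) (rank_leq_col _).
apply: leq_trans (mxrank_mxsub f f _).
rewrite mxrank_unit // unitmxE.
have -> : mxsub f f (diag_mx D) = diag_mx (\row_l D 0 (f l)).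
  by apply/matrixP => i j; rewrite !mxE (inj_eq finj).
rewrite det_diag unitfE; apply/prodf_neq0 => l _; rewrite mxE.
by have := enum_valP l; rewrite inE.
Qed.

(** In a nonincreasing sequence the positive entries form a prefix. *)
Lemma nth_sort_ge_gt0 (R : realDomainType) (s : seq R) k : (k < size s)%N ->
  (0 < (sort >=%O s)`_k) = (k < count (fun x : R => (0 < x)%R) s)%N.
Proof.
set pos := fun x : R => (0 < x)%R.
have cs : count pos (sort >=%O s) = count pos s.
  by apply/seq.permP/permEl/perm_sort.
rewrite -(size_sort >=%O s) -{}cs {}/pos.
have : sorted >=%O (sort >=%O s) by apply: sort_sorted; apply: ge_total.
move: (sort _ s) => {}s; elim: s k => [//|x s IH] k /= xs ks.
case: (ltP 0 x) => x0.
  case: k ks => [|k] /= ks; first by rewrite x0.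
  by rewrite add1n ltnS IH ?(path_sorted xs).
have /allP s0 : all (fun y => y <= 0) (x :: s).
  rewrite /= x0; apply: sub_all (order_path_min _ xs) => [y yx|].
    exact: le_trans x0.
  by move=> a b c /= ab ca; exact: le_trans ca ab.
rewrite add0n (_ : count _ _ = 0%N).
  by apply/negbTE; rewrite -leNgt; apply: s0; exact: mem_nth.
apply/eqP; rewrite -leqn0 leqNgt -has_count -all_predC; apply/allP => y ys /=.
by rewrite -leNgt s0 // inE ys orbT.
Qed.

Section SigmaRank.
Variables (R : realType) (m n : nat) (A : 'M[R]_(m, n)).
Let G : 'M[R[i]]_n := map_mx (real_complex R) (A^T *m A).

(** The spectral theorem makes A^T A similar to the diagonal matrix of its
    eigenvalues, and the rank does not change under the passage to complex
    scalars. *)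
Lemma mxrank_gram_spectral :
  \rank A = #|[pred k | spectral_diag G 0 k != 0]|.
Proof.
have := gram_normalmx A => /orthomx_spectralP; rewrite -/G => GE.
rewrite -mxrank_diag -mxrank_gram -(mxrank_map (real_complex R)) -/G {1}GE.
rewrite mxrankMfree ?row_free_unit ?spectral_unit //.
by rewrite eqmxMfull // row_full_unit unitmx_inv spectral_unit.
Qed.

(** If P is unitary and A^T A = P^* D P, then D = B^* B with B = A P^*, so each
    diagonal entry of D is the squared norm of a column of B. *)
Lemma gram_spectral_ge0 k : 0 <= spectral_diag G 0 k.
Proof.
set P := spectralmx G; set D := spectral_diag G.
have Pu : P \is unitarymx by exact: spectral_unitarymx.
have /orthomx_spectralP := gram_normalmx A; rewrite -/G -/P -/D => GE.
pose C := map_mx (real_complex R) A; pose B := C *m P ^t*.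
have CT : C ^t* = C^T.
  apply/matrixP => i j; rewrite !mxE.
  by apply/CrealP/complex_realP; exists (A j i).
have GC : G = C^T *m C by rewrite /G map_mxM /= map_trmx.
have BT : B ^t* = P *m C^T by rewrite /B trmx_mul map_mxM trmxCK CT.
have DE : diag_mx D = B ^t* *m B.
  have -> : diag_mx D = P *m G *m P ^t*.
    rewrite GE invmx_unitary // !mulmxA (unitarymxP Pu) mul1mx -mulmxA.
    by rewrite (unitarymxP Pu) mulmx1.
  by rewrite BT GC /B !mulmxA.
have /matrixP/(_ k k) := DE; rewrite !mxE eqxx mulr1n => ->.
by apply: sumr_ge0 => j _; rewrite !mxE mulrC mul_conjC_ge0.
Qed.

(** Turns the comparison of singular values into a comparison of ranks. *)
Lemma sigma_gt0 k : (0 < k <= n)%N -> (0 < sigma_ k A) = (k <= \rank A)%N.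
Proof.
move=> /andP[k0 kn]; rewrite /sigma_ /singular_values -/G.
rewrite nth_sort_ge_gt0; last by rewrite size_map size_enum_ord prednK.
rewrite prednK // mxrank_gram_spectral count_map -size_filter cardE.
rewrite enumT; congr (_ <= size _)%N; apply: eq_filter => j.
rewrite /= sqrtr_gt0 inE.
have := gram_spectral_ge0 j; case: (spectral_diag G 0 j) => a b.
rewrite lecE /= => /andP[/eqP-> a0].
by rewrite eq_complex /= eqxx andbT lt_def a0 andbT.
Qed.
End SigmaRank.

(** * Zero sets of polynomials are null *)

(** The subalgebra of functions on U generated by the functions c i.  With
    arbitrary U the same notion serves for functions of the cores and for
    functions of the tuple of their entries. *)
Inductive polynomial_in (R : realType) (U I : Type) (c : I -> U -> R) :
    (U -> R) -> Prop :=
| PolyCst a : polynomial_in c (fun=> a)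
| PolyCoord i : polynomial_in c (c i)
| PolyAdd f g : polynomial_in c f -> polynomial_in c g ->
    polynomial_in c (fun u => f u + g u)
| PolyMul f g : polynomial_in c f -> polynomial_in c g ->
    polynomial_in c (fun u => f u * g u).

Section PolynomialIn.
Variables (R : realType) (U I : Type) (c : I -> U -> R).

Lemma polynomial_in_sum (J : Type) (s : seq J) (P : pred J) (F : J -> U -> R) :
  (forall j, polynomial_in c (F j)) ->
  polynomial_in c (fun u => \sum_(j <- s | P j) F j u).
Proof.
move=> PF; elim: s => [|j s IH].
  by under eq_fun do rewrite big_nil; exact: PolyCst.
under eq_fun do rewrite big_cons.
by case: (P j) => //; exact: PolyAdd.
Qed.

Lemma polynomial_in_prod (J : Type) (s : seq J) (P : pred J) (F : J -> U -> R) :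
  (forall j, polynomial_in c (F j)) ->
  polynomial_in c (fun u => \prod_(j <- s | P j) F j u).
Proof.
move=> PF; elim: s => [|j s IH].
  by under eq_fun do rewrite big_nil; exact: PolyCst.
under eq_fun do rewrite big_cons.
by case: (P j) => //; exact: PolyMul.
Qed.

Definition polynomial_mx m n (A : U -> 'M[R]_(m, n)) :=
  forall i j, polynomial_in c (fun u => A u i j).

Lemma polynomial_mx_cst m n (A : 'M[R]_(m, n)) : polynomial_mx (fun=> A).
Proof. by move=> i j; exact: PolyCst. Qed.

Lemma polynomial_mx_mul m n p (A : U -> 'M[R]_(m, n)) (B : U -> 'M[R]_(n, p)) :
  polynomial_mx A -> polynomial_mx B -> polynomial_mx (fun u => A u *m B u).
Proof.
move=> PA PB i j; under eq_fun do rewrite mxE.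
by apply: polynomial_in_sum => k; exact: PolyMul.
Qed.

Lemma polynomial_mx_prod m (J : Type) (s : seq J) (F : J -> U -> 'M[R]_m) :
  (forall j, polynomial_mx (F j)) ->
  polynomial_mx (fun u => \prod_(j <- s) F j u).
Proof.
move=> PF; elim: s => [|j s IH].
  by under eq_fun do rewrite big_nil; exact: polynomial_mx_cst.
by under eq_fun do rewrite big_cons; exact: polynomial_mx_mul.
Qed.

Lemma polynomial_in_trace m (A : U -> 'M[R]_m) :
  polynomial_mx A -> polynomial_in c (fun u => \tr (A u)).
Proof. by move=> PA; apply: polynomial_in_sum => i; exact: PA. Qed.

Lemma polynomial_in_det m (A : U -> 'M[R]_m) :
  polynomial_mx A -> polynomial_in c (fun u => \det (A u)).
Proof.
move=> PA; apply: polynomial_in_sum => s; apply: PolyMul; first exact: PolyCst.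
by apply: polynomial_in_prod => i; exact: PA.
Qed.

End PolynomialIn.

(** With the flattening of the cores for F, this transfers a polynomial in the
    entries of the cores to the space of tuples, which carries the measure. *)
Lemma polynomial_in_comp (R : realType) (U V I : Type) (F : V -> U)
    (c : I -> U -> R) (f : V -> R) :
  polynomial_in (fun i v => c i (F v)) f ->
  exists2 g, polynomial_in c g & forall v, f v = g (F v).
Proof.
elim=> [a|i|f1 f2 _ [g1 P1 E1] _ [g2 P2 E2]|f1 f2 _ [g1 P1 E1] _ [g2 P2 E2]].
- by exists (fun=> a) => //; exact: PolyCst.
- by exists (c i) => //; exact: PolyCoord.
- by exists (fun u => g1 u + g2 u) => [|v]; [exact: PolyAdd|rewrite E1 E2].
- by exists (fun u => g1 u * g2 u) => [|v]; [exact: PolyMul|rewrite E1 E2].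
Qed.

Lemma finite_roots (F : idomainType) (p : {poly F}) :
  p != 0 -> finite_set [set x | root p x].
Proof.
move=> p0; apply: contrapT => /(@infinite_set_fset _ _ (size p))[B Bp].
apply/negP; rewrite -ltnNge; apply: max_poly_roots => //; last exact: fset_uniq.
by apply/allP => x xB; exact: Bp.
Qed.

Section ZeroSet.
Variable R : realType.

Local Notation coord m := (fun (i : 'I_m) (t : m.-tuple R) => tnth t i).

Lemma measurable_polynomial m (f : m.-tuple R -> R) :
  polynomial_in (coord m) f -> measurable_fun setT f.
Proof.
elim=> [a|i|f1 f2 _ m1 _ m2|f1 f2 _ m1 _ m2].
- exact: measurable_cst.
- exact: measurable_tnth.
- exact: measurable_funD.
- exact: measurable_funM.
Qed.

Lemma tnth_cons_pair m x (t : m.-tuple R) j :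
  tnth (cons_pair (x, t)) (lift ord0 j) = tnth t j.
Proof. exact: tnthS. Qed.

Lemma polynomial_tail m (f : m.+1.-tuple R -> R) x :
  polynomial_in (coord m.+1) f ->
  polynomial_in (coord m) (fun t => f (cons_pair (x, t))).
Proof.
elim=> [a|i|f1 f2 _ P1 _ P2|f1 f2 _ P1 _ P2].
- exact: PolyCst.
- case: (unliftP ord0 i) => [j ->|->]; last exact: (PolyCst _ x).
  rewrite (_ : (fun t => _) = coord m j); first exact: PolyCoord.
  by apply/funext => t; exact: tnth_cons_pair.
- exact: PolyAdd.
- exact: PolyMul.
Qed.

Lemma polynomial_head m (f : m.+1.-tuple R -> R) t :
  polynomial_in (coord m.+1) f ->
  exists p : {poly R}, forall x, f (cons_pair (x, t)) = p.[x].
Proof.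
elim=> [a|i|f1 f2 _ [p1 E1] _ [p2 E2]|f1 f2 _ [p1 E1] _ [p2 E2]].
- by exists a%:P => x; rewrite hornerC.
- case: (unliftP ord0 i) => [j ->|->]; last by exists 'X => x; rewrite hornerX.
  by exists (tnth t j)%:P => x; rewrite hornerC; exact: tnth_cons_pair.
- by exists (p1 + p2) => x; rewrite hornerD E1 E2.
- by exists (p1 * p2) => x; rewrite hornerM E1 E2.
Qed.

Lemma measurable_zeros m (f : m.-tuple R -> R) :
  polynomial_in (coord m) f -> measurable [set t | f t = 0].
Proof.
move=> /measurable_polynomial mf.
rewrite -[X in measurable X]setTI.
exact: (mf measurableT [set 0] (measurable_set1 0)).
Qed.

(** Induction on the number of variables, with the first variable x outside in
    Fubini's theorem.  Fixing the other variables at those of t0 gives a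
    nonzero univariate polynomial p; if x is not one of its finitely many
    roots, the section at x is the zero set of a polynomial that is not zero at
    the tail of t0, hence is null by induction. *)
Lemma polynomial_zeros_null m (f : m.-tuple R -> R) t0 :
  polynomial_in (coord m) f -> f t0 != 0 ->
  lebesgue_tuple R m [set t | f t = 0] = 0%E.
Proof.
elim: m => [|m IH] in f t0 *.
  move=> _ ft0; rewrite /= diracE memNset //= => f0.
  by move/eqP: ft0; apply; rewrite (tuple0 t0).
move=> Pf ft0.
have mA := measurable_zeros Pf.
set A := [set t | f t = 0] in mA *.
rewrite /= /lebesgue_step /pushforward /product_measure1 /=.
have [p pE] := polynomial_head (uncons_pair t0).2 Pf.
have p0 : p != 0.
  apply: contraNneq ft0 => p0; have := pE (thead t0).
  rewrite p0 horner0 => <-; apply/eqP; congr f.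
  by apply: val_inj; rewrite /= [in LHS](tuple_eta t0).
pose Z := [set x : R | root p x].
have cZ : countable Z by exact/finite_set_countable/finite_roots.
have Z0 : lebesgue_measure Z = 0%E by exact: countable_lebesgue_measure0.
have mZ : measurable Z by exact: countable_measurable.
rewrite (@ge0_negligible_integral _ (measurableTypeR R) R lebesgue_measure
  setT Z) //; last first.
  apply: measurable_fun_xsection.
  rewrite -[X in measurable X]setTI.
  exact: measurable_cons_pair.
apply: integral0_eq => x [_ /= Zx].
rewrite (_ : xsection _ x = [set t | f (cons_pair (x, t)) = 0]).
  apply: (IH _ (uncons_pair t0).2); first exact: polynomial_tail.
  by rewrite pE; apply/negP.
by apply/seteqP; split => t; rewrite /xsection /= => h;
  [exact: set_mem h|exact: mem_set].
Qed.
End ZeroSet.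

(** * The tensor as the trace of a product of padded matrices *)

Section Embed.
Variable R : comPzRingType.

(** A moved to the upper left corner of an m' x n' matrix, padded with zeros or
    truncated.  Writing it as a product makes its multiplicativity a matter of
    [mul_pid_mx]. *)
Definition embed_mx m' n' m n (A : 'M[R]_(m, n)) : 'M[R]_(m', n') :=
  pid_mx m *m A *m pid_mx n.

Lemma embed_mx_mul L m n p (A : 'M[R]_(m, n)) (B : 'M[R]_(n, p)) :
  (n <= L)%N ->
  embed_mx L L (A *m B) = embed_mx L L A *m embed_mx L L B.
Proof.
move=> nL; rewrite /embed_mx !mulmxA -(mulmxA _ (pid_mx n) (pid_mx n)).
by rewrite pid_mx_id // pid_mx_1 mulmx1.
Qed.

Lemma embed_mx_trace L m (A : 'M[R]_m) : (m <= L)%N ->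
  \tr (embed_mx L L A) = \tr A.
Proof.
by move=> mL; rewrite mxtrace_mulC mulmxA pid_mx_id // pid_mx_1 mul1mx.
Qed.

(** Lets cores of size K be placed in cores with the prescribed bond dimensions
    without a change of the tensor. *)
Lemma embed_mx_embed L m n k l (A : 'M[R]_(k, l)) : (k <= m)%N -> (l <= n)%N ->
  embed_mx L L (embed_mx m n A) = embed_mx L L A.
Proof.
move=> km ln; rewrite /embed_mx !mulmxA mul_pid_mx -mulmxA mul_pid_mx.
by rewrite !(minn_idPr km) (minn_idPl ln) (minn_idPr ln).
Qed.

Lemma embed_mx_cast m' n' m n p q (e : (m = p) * (n = q)) (A : 'M[R]_(m, n)) :
  embed_mx m' n' (castmx e A) = embed_mx m' n' A.
Proof. by case: e => em en; case: p / em; case: q / en; rewrite castmx_id. Qed.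

(** The empty product is excluded: the padded identity is an identity only if
    k = L. *)
Lemma embed_mx_prod L k (F : nat -> 'M[R]_k) m : (k <= L)%N -> (0 < m)%N ->
  embed_mx L L (\prod_(0 <= i < m) F i) = \prod_(0 <= i < m) embed_mx L L (F i).
Proof.
move=> kL; case: m => // m _; elim: m => [|m IH]; first by rewrite !big_nat1.
by rewrite big_nat_recr //= [in RHS]big_nat_recr //= -IH; exact: embed_mx_mul.
Qed.

Lemma mul_delta_mx4_trace k (A B C D : 'I_k * 'I_k) :
  \tr (delta_mx A.1 A.2 *m delta_mx B.1 B.2 *m delta_mx C.1 C.2
        *m delta_mx D.1 D.2 : 'M[R]_k) =
  [&& A.2 == B.1, B.2 == C.1, C.2 == D.1 & D.2 == A.1]%:R.
Proof.
have tr_delta : \tr (delta_mx A.1 D.2 : 'M[R]_k) = (D.2 == A.1)%:R.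
  rewrite /mxtrace (bigD1 A.1) //= big1 ?addr0; last first.
    by move=> i /negPf iA; rewrite mxE iA.
  by rewrite mxE eqxx eq_sym.
do 3! rewrite mul_delta_mx_cond -scaler_nat -?scalemxAl.
by rewrite !linearZ /= tr_delta -!natrM !mulnb.
Qed.

End Embed.

Section Ring.
Variables (R : realType) (d : nat) (d_gt0 : (0 < d)%N).
Variables (n r : 'I_d -> nat) (tau : 'S_d).
Implicit Type u : ring_cores R r n tau.

(** The ring is indexed by natural numbers, as by the recursion that defines the
    tensor, so that a product over it can be cut at any place. *)
Definition ring_site k : 'I_d := iter k (@ordS d) (Ordinal d_gt0).

Lemma ring_siteE k : (k < d)%N -> ring_site k = k :> nat.
Proof.
rewrite /ring_site; elim: k => [//|k IH] kd /=.
by rewrite IH ?(ltnW kd) // modn_small.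
Qed.

Definition position (i : 'I_d) : nat := (tau^-1)%g i.

Lemma position_lt i : (position i < d)%N.
Proof. exact: ltn_ord. Qed.

Lemma ring_site_position i : tau (ring_site (position i)) = i.
Proof.
rewrite -[RHS](permKV tau); congr (tau _).
by apply: ord_inj; rewrite ring_siteE ?position_lt.
Qed.

Lemma position_ring_site k : (k < d)%N -> position (tau (ring_site k)) = k.
Proof. by move=> kd; rewrite /position permK ring_siteE. Qed.

Lemma position_inj : injective position.
Proof. by move=> i j /val_inj /perm_inj. Qed.

Definition site_mx L u (x : forall i, 'I_(n i)) (i : 'I_d) : 'M[R]_L :=
  embed_mx L L (u i (x i)).

(** Padding all slices to size L removes the type casts from the definition of
    the tensor; it preserves products and the trace because no bond dimension
    exceeds L. *)
Lemma ring_tensorE L u x : (forall j, (r j <= L)%N) ->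
  ring_tensor d_gt0 u x =
    \tr (\prod_(0 <= k < d) site_mx L u x (tau (ring_site k))).
Proof.
move=> rL; rewrite /ring_tensor -(embed_mx_trace _ (rL _)) embed_mx_cast.
congr (\tr _); set B := (fun k : 'I_d => _).
have H j m : (0 < m)%N -> embed_mx L L (ring_mulmx B j m) =
    \prod_(0 <= k < m) embed_mx L L (B (iter k (@ordS d) j)).
  case: m => // m _; elim: m => [|m IH]; first by rewrite big_nat1 /= mul1mx.
  by rewrite big_nat_recr //= -IH; exact: embed_mx_mul.
rewrite H //; apply: eq_bigr => k _.
by rewrite /B embed_mx_cast.
Qed.

End Ring.

(** * Rank bound from cutting the ring twice *)

(** tr(A_i B_j) is the scalar product of A_i and the transpose of B_j, seen as
    vectors of length L^2, so D factors through dimension L^2. *)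
Lemma mxrank_trace_le (F : fieldType) L m n (D : 'M[F]_(m, n))
    (A : 'I_m -> 'M[F]_L) (B : 'I_n -> 'M[F]_L) :
  (forall i j, D i j = \tr (A i *m B j)) -> (\rank D <= L * L)%N.
Proof.
move=> DE.
have -> : D = (\matrix_i mxvec (A i)) *m (\matrix_j mxvec (B j)^T)^T.
  apply/matrixP => i j; rewrite DE [RHS]mxE.
  rewrite (reindex _ (curry_mxvec_bij L L)) /= /mxtrace.
  under [LHS]eq_bigr do rewrite mxE.
  rewrite pair_bigA /=; apply: eq_bigr => -[a b] _ /=.
  by rewrite !mxE !mxvecE mxE.
by apply: leq_trans (mxrankM_maxl _ _) (rank_leq_col _).
Qed.

Section Update.
Variables (I : eqType) (T : I -> Type).

Lemma dfwithC (f : forall i, T i) i j (x : T i) (z : T j) : i != j ->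
  dfwith (dfwith f i x) j z = dfwith (dfwith f j z) i x.
Proof.
move=> ij; apply: functional_extensionality_dep => k.
have [<-|jk] := eqVneq j k.
  by rewrite dfwithin dfwithout // dfwithin.
rewrite dfwithout //; have [<-|ik] := eqVneq i k; first by rewrite !dfwithin.
by rewrite !dfwithout.
Qed.

Lemma dfwith_eq (f g : forall i, T i) i (x : T i) k :
  f k = g k -> dfwith f i x k = dfwith g i x k.
Proof.
by move=> fg; have [<-|ik] := eqVneq i k; rewrite ?dfwithin // !dfwithout.
Qed.

End Update.

Section Separated.
Variables (R : realType) (d : nat) (d_gt0 : (0 < d)%N).
Variables (n r : 'I_d -> nat) (tau : 'S_d).
Variables (u : ring_cores R r n tau) (L : nat) (rL : forall j, (r j <= L)%N).
Variable y : forall i, 'I_(n i).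

Let T := ring_tensor d_gt0 u.
Local Notation p := (position tau).

(** Cutting the ring before the places s and t.  The two pieces of the product
    outside the arc are joined by cyclicity of the trace. *)
Lemma ring_tensor_cut s t : (s <= t <= d)%N ->
  exists A B : (forall i, 'I_(n i)) -> 'M[R]_L,
  [/\ forall x, T x = \tr (A x *m B x),
      forall x x', (forall i, (s <= p i < t)%N -> x i = x' i) -> A x = A x' &
      forall x x', (forall i, ~~ (s <= p i < t)%N -> x i = x' i) -> B x = B x'].
Proof.
move=> /andP[st td].
pose P a b x : 'M[R]_L :=
  \prod_(a <= k < b) site_mx L u x (tau (ring_site d_gt0 k)).
have PE a b x x' : (b <= d)%N -> (forall i, (a <= p i < b)%N -> x i = x' i) ->
    P a b x = P a b x'.
  move=> bd xx'; rewrite /P !big_nat; apply: eq_bigr => k /andP[ak kb].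
  rewrite /site_mx xx' // position_ring_site ?ak //; exact: leq_trans bd.
exists (P s t), (fun x => P t d x *m P 0%N s x); split=> [x|x x' xx'|x x' xx'].
- rewrite /T (ring_tensorE _ _ _ rL) (@big_cat_nat _ _ _ s) //=; last first.
    exact: leq_trans td.
  rewrite (@big_cat_nat _ _ _ t s d) //= -!mulmxE.
  by rewrite [LHS]mxtrace_mulC mulmxA.
- exact: PE.
- congr (_ *m _); apply: PE => [|i h] //; last 2 first.
  + exact: leq_trans td.
  + by apply: xx'; lia.
  by apply: xx'; lia.
Qed.

Variables j1 j2 j3 j4 : 'I_d.
Let D := mat12_34 T j1 j2 j3 j4 y.

(** The two factors of the cut depend on the row index only and on the column
    index only, in one order or the other. *)
Lemma mxrank_separated s t : (s <= t <= d)%N ->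
    let inside j := (s <= p j < t)%N in
    [&& inside j1, inside j2, ~~ inside j3 & ~~ inside j4] ||
    [&& ~~ inside j1, ~~ inside j2, inside j3 & inside j4] ->
  (\rank D <= L * L)%N.
Proof.
move=> /ring_tensor_cut[A [B [TE AE BE]]] inside.
pose X12 (q : 'I_(n j1 * n j2)) := dfwith (dfwith y _ (mxtens_unindex q).1)
  _ (mxtens_unindex q).2.
pose X34 (q : 'I_(n j3 * n j4)) := dfwith (dfwith y _ (mxtens_unindex q).1)
  _ (mxtens_unindex q).2.
pose X a (b : 'I_(n j3 * n j4)) :=
  dfwith (dfwith (X12 a) _ (mxtens_unindex b).1) _ (mxtens_unindex b).2.
have DE a b : D a b = \tr (A (X a b) *m B (X a b)) by rewrite mxE -TE.
have X12E a b i : i != j3 -> i != j4 -> X a b i = X12 a i.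
  by move=> i3 i4; rewrite /X !dfwithout // eq_sym.
have X34E a b i : i != j1 -> i != j2 -> X a b i = X34 b i.
  by move=> i1 i2; do 2 apply: dfwith_eq; rewrite /X12 !dfwithout // eq_sym.
have neq i j : inside i != inside j -> i != j by apply: contraNneq => ->.
case/orP => /and4P[h1 h2 h3 h4].
- apply: (@mxrank_trace_le _ _ _ _ _ (A \o X12) (B \o X34)) => a b.
  rewrite DE; congr (\tr (_ *m _)) => /=.
    by apply: AE => i; rewrite -/(inside i) => h; apply: X12E; apply: neq;
      rewrite h ?(negPf h3) ?(negPf h4).
  by apply: BE => i; rewrite -/(inside i) => h; apply: X34E; apply: neq;
    rewrite (negPf h) ?h1 ?h2.
- apply: (@mxrank_trace_le _ _ _ _ _ (B \o X12) (A \o X34)) => a b.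
  rewrite DE mxtrace_mulC; congr (\tr (_ *m _)) => /=.
    by apply: BE => i; rewrite -/(inside i) => h; apply: X12E; apply: neq;
      rewrite (negPf h) ?h3 ?h4.
  by apply: AE => i; rewrite -/(inside i) => h; apply: X34E; apply: neq;
    rewrite h ?(negPf h1) ?(negPf h2).
Qed.

End Separated.

(** * Cyclic orders of four points *)

Definition cyclically_sorted (a b c e : nat) :=
  [|| [&& a < b, b < c & c < e], [&& b < c, c < e & e < a],
      [&& c < e, e < a & a < b] | [&& e < a, a < b & b < c]]%N.

(** The pairs a, b and c, e interlace around the circle. *)
Definition crossing (a b c e : nat) :=
  cyclically_sorted a c b e || cyclically_sorted a e b c.

(** Four points on a circle have three cyclic orders up to reversal, one for
    each splitting into two pairs. *)
Lemma crossing_exactly_one a b c e : uniq [:: a; b; c; e] ->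
  [|| crossing a b c e && ~~ crossing a c b e && ~~ crossing a e b c,
      ~~ crossing a b c e && crossing a c b e && ~~ crossing a e b c |
      ~~ crossing a b c e && ~~ crossing a c b e && crossing a e b c].
Proof.
rewrite /= !inE /crossing /cyclically_sorted.
by case: (ltngtP a b) => //= ab; case: (ltngtP a c) => //= ac;
  case: (ltngtP b c) => //= bc; case: (ltngtP a e) => //= ae;
  case: (ltngtP b e) => //= be; case: (ltngtP c e) => //= ce; lia.
Qed.

(** One of the two pairs spans an interval that misses the other pair. *)
Lemma noncrossing_separated a b c e m : uniq [:: a; b; c; e] ->
    (maxn (maxn a b) (maxn c e) < m)%N -> ~~ crossing a b c e ->
  exists s t, (s <= t <= m)%N /\
    let inside j := (s <= j < t)%N in
    [&& inside a, inside b, ~~ inside c & ~~ inside e] ||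
    [&& ~~ inside a, ~~ inside b, inside c & inside e].
Proof.
rewrite /= !inE => + lt_m + /=.
have [h|h] := boolP [&& ~~ (minn a b <= c < (maxn a b).+1)%N &
                        ~~ (minn a b <= e < (maxn a b).+1)%N].
  move=> _ _; exists (minn a b), (maxn a b).+1; lia.
move=> u nc; exists (minn c e), (maxn c e).+1; split; first lia.
apply/orP; right; move: h u nc lt_m; rewrite /crossing /cyclically_sorted.
by case: (ltngtP a b) => //= ab; case: (ltngtP a c) => //= ac;
  case: (ltngtP b c) => //= bc; case: (ltngtP a e) => //= ae;
  case: (ltngtP b e) => //= be; case: (ltngtP c e) => //= ce; lia.
Qed.

(** Interlaced pairs alternate, so listing them alternately gives a rotation of
    a monotone order. *)
Lemma crossing_correct_order d (tau : 'S_d) (i1 i2 i3 i4 : 'I_d) :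
    crossing (position tau i1) (position tau i2)
             (position tau i3) (position tau i4) ->
  correct_order tau [tuple i1; i3; i2; i4].
Proof.
rewrite /position /crossing /cyclically_sorted /correct_order.
set a := nat_of_ord ((tau^-1)%g i1); set b := nat_of_ord ((tau^-1)%g i2).
set c := nat_of_ord ((tau^-1)%g i3); set e := nat_of_ord ((tau^-1)%g i4) => h.
(* One disjunct for each starting index s of the rotation. *)
have : [\/ [|| [&& a < c, c < b & b < e] | [&& e < b, b < c & c < a]]%N,
       [|| [&& c < b, b < e & e < a] | [&& a < e, e < b & b < c]]%N,
       [|| [&& b < e, e < a & a < c] | [&& c < a, a < e & e < b]]%N |
       [|| [&& e < a, a < c & c < b] | [&& b < c, c < a & a < e]]%N].
  case/orP: h => /or4P[] h;
    [apply: Or41|apply: Or42|apply: Or43|apply: Or44|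
     apply: Or42|apply: Or41|apply: Or44|apply: Or43]; lia.
case=> h'; [exists 0|exists 1|exists 2%:R|exists 3%:R];
  rewrite !(tnth_nth i1) /=; case/orP: h' => /and3P[]; by [left|right].
Qed.

(** * Cores made of elementary matrices *)

Lemma prod_nat_skip1 (S : pzSemiRingType) (W : nat -> S) a q b :
    (a <= q < b)%N ->
  (forall k, (a <= k < q)%N -> W k = 1) ->
  \prod_(a <= k < b) W k = W q * \prod_(q.+1 <= k < b) W k.
Proof.
move=> /andP[aq qb] W1.
rewrite (@big_cat_nat _ _ _ q) ?(ltnW qb) //= big_nat big1 ?mul1r; last first.
  by move=> k; exact: W1.
by rewrite big_ltn.
Qed.

Section Witness.
Variables (R : realType) (d : nat) (d_gt0 : (0 < d)%N).
Variables (n r : 'I_d -> nat) (tau : 'S_d) (K : nat).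
Hypotheses (n_ge : forall i, (K ^ 2 <= n i)%N) (r_ge : forall j, (K <= r j)%N).
Variable S : seq 'I_d.

Local Notation p := (position tau).

(** The slice of site i that carries the elementary matrix E_ab, where the
    argument is the pair (a, b). *)
Definition pair_slice i (a : 'I_K * 'I_K) : 'I_(n i) :=
  widen_ord (n_ge i) (mxtens_index a).

(** Slices beyond the first K^2 are never looked at; 0 is a default value. *)
Definition witness_mx i (v : 'I_(n i)) : 'M[R]_K :=
  if i \in S then
    if insub (v : nat) is Some c then
      delta_mx (mxtens_unindex (c : 'I_(K * K))).1 (mxtens_unindex c).2
    else 0
  else 1%:M.

Definition witness : ring_cores R r n tau :=
  fun i v => embed_mx _ _ (witness_mx v).

Lemma witness_mx_pair i a : i \in S ->
  witness_mx (pair_slice i a) = delta_mx a.1 a.2.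
Proof.
move=> iS; rewrite /witness_mx iS.
have -> : insub (mxtens_index a : nat) = Some (mxtens_index a) by exact: valK.
by rewrite mxtens_indexK.
Qed.

Lemma ring_tensor_witness x : ring_tensor d_gt0 witness x =
  \tr (\prod_(0 <= k < d) witness_mx (x (tau (ring_site d_gt0 k)))).
Proof.
have rL j : (r j <= \max_i r i)%N by exact: leq_bigmax.
have KL : (K <= \max_i r i)%N := leq_trans (r_ge (Ordinal d_gt0)) (rL _).
rewrite (ring_tensorE _ _ _ rL) -(embed_mx_trace _ KL) embed_mx_prod //.
by congr (\tr _); apply: eq_bigr => k _; rewrite /site_mx embed_mx_embed.
Qed.

(** The sites outside S contribute identities, which leaves the trace of four
    elementary matrices. *)
Lemma ring_tensor_witness_sorted i1 i2 i3 i4 x a1 a2 a3 a4 :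
    S =i [:: i1; i2; i3; i4] -> [&& p i1 < p i2, p i2 < p i3 & p i3 < p i4]%N ->
    x i1 = pair_slice i1 a1 -> x i2 = pair_slice i2 a2 ->
    x i3 = pair_slice i3 a3 -> x i4 = pair_slice i4 a4 ->
  ring_tensor d_gt0 witness x =
    [&& a1.2 == a2.1, a2.2 == a3.1, a3.2 == a4.1 & a4.2 == a1.1]%:R.
Proof.
move=> SE /and3P[p12 p23 p34] x1 x2 x3 x4; rewrite ring_tensor_witness.
set W := fun k : nat => witness_mx (x (tau (ring_site d_gt0 k))).
have Wp i : W (p i) = witness_mx (x i).
  rewrite /W; move: (ring_site _ _) (ring_site_position d_gt0 tau i) => j.
  by case: _ /.
have W1 k : (k < d)%N -> k \notin [:: p i1; p i2; p i3; p i4] -> W k = 1.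
  move=> kd knot; rewrite /W /witness_mx ifN // SE.
  by apply: contraNN knot => /(map_f p); rewrite position_ring_site.
have pd := position_lt tau i4.
rewrite (@prod_nat_skip1 _ W 0 (p i1)) ?(@prod_nat_skip1 _ W (p i1).+1 (p i2))
  ?(@prod_nat_skip1 _ W (p i2).+1 (p i3))
  ?(@prod_nat_skip1 _ W (p i3).+1 (p i4)).
rewrite (@big_nat _ _ _ (p i4).+1) big1 ?mulr1 ?mulrA; last first.
  by move=> k kd; apply: W1; rewrite ?inE; lia.
rewrite !Wp x1 x2 x3 x4 !witness_mx_pair ?SE ?inE ?eqxx ?orbT //.
exact: mul_delta_mx4_trace.
all: try (by move=> k kd; apply: W1; rewrite ?inE; lia).
all: lia.
Qed.

(** The condition on the subscripts is invariant under rotation, hence only the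
    cyclic order of the four sites matters. *)
Lemma ring_tensor_witness_cyclic i1 i2 i3 i4 x a1 a2 a3 a4 :
    S =i [:: i1; i2; i3; i4] -> cyclically_sorted (p i1) (p i2) (p i3) (p i4) ->
    x i1 = pair_slice i1 a1 -> x i2 = pair_slice i2 a2 ->
    x i3 = pair_slice i3 a3 -> x i4 = pair_slice i4 a4 ->
  ring_tensor d_gt0 witness x =
    [&& a1.2 == a2.1, a2.2 == a3.1, a3.2 == a4.1 & a4.2 == a1.1]%:R.
Proof.
move=> SE cyc x1 x2 x3 x4.
have rot4 (b1 b2 b3 b4 : bool) : [&& b1, b2, b3 & b4] = [&& b2, b3, b4 & b1].
  by case: b1 b2 b3 b4 => [] [] [] [].
have SE' k : S =i rot k [:: i1; i2; i3; i4] by move=> i; rewrite SE mem_rot.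
case/or4P: cyc => h.
- exact: ring_tensor_witness_sorted x1 x2 x3 x4.
- rewrite rot4; exact: (ring_tensor_witness_sorted (SE' 1%N) h x2 x3 x4 x1).
- rewrite 2!rot4; exact: (ring_tensor_witness_sorted (SE' 2%N) h x3 x4 x1 x2).
- rewrite 3!rot4; exact: (ring_tensor_witness_sorted (SE' 3%N) h x4 x1 x2 x3).
Qed.

End Witness.

(** * Permuting the sites of a matricization *)

Section Slices.
Variables (R : realType) (d : nat) (n : 'I_d -> nat) (T : tensor R n).
Variables (i1 i2 i3 i4 : 'I_d) (y : forall i, 'I_(n i)).
Hypothesis i_uniq : uniq [:: i1; i2; i3; i4].

(** Reduces the study of ranks to one matricization, of four arbitrary sites. *)
Lemma mat13_24E : mat13_24 T i1 i2 i3 i4 y = mat12_34 T i1 i3 i2 i4 y.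
Proof.
apply/matrixP => a b; rewrite !mxE /slice; congr (T (dfwith _ i4 _)).
apply: dfwithC; move: i_uniq; rewrite /= !inE !negb_or.
by case/and4P=> _ /andP[].
Qed.

Lemma mat14_23E : mat14_23 T i1 i2 i3 i4 y = mat12_34 T i1 i4 i2 i3 y.
Proof.
apply/matrixP => a b; rewrite !mxE /slice; congr T.
move: i_uniq; rewrite /= !inE !negb_or => /and4P[_ /andP[i23 i24] i34 _].
by rewrite (dfwithC _ _ _ i34); congr (dfwith _ i3 _); exact: dfwithC.
Qed.

End Slices.

(** * Polynomials in the entries of the cores *)

Section Coords.
Variables (R : realType) (d : nat) (n r : 'I_d -> nat) (tau : 'S_d).
Local Notation cores := (ring_cores R r n tau).

Definition core_coord (k : 'I_#|ring_coord r n tau|) (u : cores) : R :=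
  tnth (ring_flatten u) k.

Lemma ring_null_zeros (f : cores -> R) u0 :
  polynomial_in core_coord f -> f u0 != 0 -> ring_null [set u | f u = 0].
Proof.
move=> Pf fu0.
have [g Pg fg] := polynomial_in_comp (F := @ring_flatten R d r n tau)
  (c := fun i t => tnth t i) Pf.
rewrite /ring_null.
apply: (@negligibleS _ _ _ _ [set t | g t = 0]).
  by move=> _ [u fu <-] /=; rewrite -fg.
apply/negligibleP; first exact: measurable_zeros.
by apply: (polynomial_zeros_null (t0 := ring_flatten u0)) => //; rewrite -fg.
Qed.

Lemma polynomial_core i (v : 'I_(n i)) :
  polynomial_mx core_coord (fun u : cores => u i v).
Proof.
move=> a b.
pose k := enum_rank (Tagged (fun i : 'I_d =>
  'I_(r (tau^-1 i)%g) * 'I_(n i) * 'I_(r (ordS (tau^-1 i)%g)))%type (a, v, b)).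
rewrite (_ : (fun u => _) = core_coord k); first exact: PolyCoord.
by apply/funext => u; rewrite /core_coord tnth_mktuple enum_rankK.
Qed.

Lemma polynomial_ring_tensor (d_gt0 : (0 < d)%N) x :
  polynomial_in core_coord (fun u : cores => ring_tensor d_gt0 u x).
Proof.
have rL j : (r j <= \max_i r i)%N by exact: leq_bigmax.
under eq_fun do rewrite (ring_tensorE _ _ _ rL).
apply/polynomial_in_trace/polynomial_mx_prod => k.
do ![apply: polynomial_mx_mul]; try exact: polynomial_mx_cst.
exact: polynomial_core.
Qed.

End Coords.

(** * Ranks of the interlaced and of the other matricizations *)

Section Main.
Variables (R : realType) (d : nat) (d_gt0 : (0 < d)%N).
Variables (n r : 'I_d -> nat) (tau : 'S_d) (K : nat).
Hypotheses (n_ge : forall i, (K ^ 2 <= n i)%N) (r_ge : forall j, (K <= r j)%N).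
Hypothesis r_lt : forall j, (r j < K ^ 2)%N.
Variables j1 j2 j3 j4 : 'I_d.
Local Notation p := (position tau).
Local Notation M u y := (mat12_34 (ring_tensor d_gt0 u) j1 j2 j3 j4 y).
Hypothesis j_uniq : uniq [:: j1; j2; j3; j4].

Lemma noncrossing_rank (u : ring_cores R r n tau) y :
  ~~ crossing (p j1) (p j2) (p j3) (p j4) -> (\rank (M u y) < K ^ 4)%N.
Proof.
move=> /(noncrossing_separated (m := d))[||s [t [st inside]]].
- by rewrite (map_inj_uniq (@position_inj _ tau) [:: j1; j2; j3; j4]).
- by rewrite !gtn_max !position_lt.
have rL j : (r j <= (K ^ 2).-1)%N by have := r_lt j; case: (K ^ 2)%N.
apply: leq_ltn_trans (mxrank_separated d_gt0 u rL y st inside) _.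
have := r_lt j1; rewrite (expnM K 2 2); case: (K ^ 2)%N => // L _ /=.
by rewrite ltn_sqr.
Qed.

(** Rows are labelled by the subscripts (a1, b1), (a2, b2) of the slices at j1
    and j2, and G gives the only subscripts at j3 and j4 that match them: for
    the order j1, j3, j2, j4 these are (b1, a2) and (b2, a1), for the order
    j1, j4, j2, j3 they are (b2, a1) and (b1, a2). *)
Lemma crossing_minor :
    crossing (p j1) (p j2) (p j3) (p j4) ->
  exists (f : 'I_(K ^ 4) -> 'I_(n j1 * n j2)) (g : 'I_(K ^ 4) -> _)
    (u : ring_cores R r n tau),
  forall y, mxsub f g (M u y) = 1%:M.
Proof.
pose X : finType := ('I_K * 'I_K * ('I_K * 'I_K))%type.
have cardX : (K ^ 4)%N = #|X| by rewrite !card_prod !card_ord !mulnn -expnM.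
pose e (k : 'I_(K ^ 4)) : X := enum_val (cast_ord cardX k).
have e_inj : injective e by move=> a b /enum_val_inj/cast_ord_inj.
pose v := pair_slice n_ge.
pose w := @witness R d n r tau K [:: j1; j2; j3; j4].
move=> cr.
suff [G GE] : exists G : X -> X, forall x A B,
    x j1 = v j1 A.1 -> x j2 = v j2 A.2 ->
    x j3 = v j3 (G B).1 -> x j4 = v j4 (G B).2 ->
    ring_tensor d_gt0 w x = (A == B)%:R.
  exists (fun k => mxtens_index (v j1 (e k).1, v j2 (e k).2)).
  exists (fun k => mxtens_index (v j3 (G (e k)).1, v j4 (G (e k)).2)).
  exists w => y; apply/matrixP => a b.
  rewrite !mxE !mxtens_indexK /slice -(inj_eq e_inj).
  move: j_uniq; rewrite /= !inE !negb_or.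
  move=> /and4P[/and3P[j12 j13 j14] /andP[j23 j24] j34 _].
  by apply: GE; [rewrite 3?dfwithout|rewrite 2?dfwithout|rewrite dfwithout|];
    rewrite ?dfwithin // eq_sym.
case/orP: cr => cyc.
- exists (fun B => ((B.1.2, B.2.1), (B.2.2, B.1.1))) => x A B x1 x2 x3 x4.
  rewrite (ring_tensor_witness_cyclic R d_gt0 r_ge _ cyc x1 x3 x2 x4).
    case: A B {x1 x2 x3 x4} => [[? ?] [? ?]] [[? ?] [? ?]] /=.
    by congr (_%:R); rewrite !xpair_eqE; do ![case: eqP => //= ?]; congruence.
  by move=> i; rewrite !inE; do ![case: eqP => //=].
- exists (fun B => ((B.2.2, B.1.1), (B.1.2, B.2.1))) => x A B x1 x2 x3 x4.
  rewrite (ring_tensor_witness_cyclic R d_gt0 r_ge _ cyc x1 x4 x2 x3).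
    case: A B {x1 x2 x3 x4} => [[? ?] [? ?]] [[? ?] [? ?]] /=.
    by congr (_%:R); rewrite !xpair_eqE; do ![case: eqP => //= ?]; congruence.
  by move=> i; rewrite !inE; do ![case: eqP => //=].
Qed.

(** One minor works for all y, so the product over y of its determinants is a
    nonzero polynomial; where it does not vanish the rank is at least K^4. *)
Lemma crossing_generic_rank :
    crossing (p j1) (p j2) (p j3) (p j4) ->
  ring_null [set u : ring_cores R r n tau |
    exists y, (\rank (M u y) < K ^ 4)%N].
Proof.
move=> /crossing_minor[f [g [u0 u0E]]].
pose P (u : ring_cores R r n tau) :=
  \prod_(y : {dffun forall i, 'I_(n i)}) \det (mxsub f g (M u y)).
have PP : polynomial_in (@core_coord R d n r tau) P.
  apply: polynomial_in_prod => y; apply: polynomial_in_det => a b.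
  under eq_fun do rewrite 2!mxE; exact: polynomial_ring_tensor.
have Pu0 : P u0 != 0 by apply/prodf_neq0 => y _; rewrite u0E det1 oner_neq0.
apply: negligibleS (ring_null_zeros PP Pu0).
apply: image_subset => u [y rk] /=; apply/eqP/prodf_eq0.
exists (finfun y) => //.
rewrite (_ : finfun y = y :> (forall i, 'I_(n i))); last first.
  by apply: functional_extensionality_dep => i; rewrite ffunE.
apply: contraTT rk; rewrite -leqNgt -unitfE -unitmxE => /mxrank_unit.
by rewrite -[X in X = _ -> _]/(\rank _) => <-; exact: mxrank_mxsub.
Qed.

End Main.

Theorem theorem4p2 (R : realType) (d : nat) (d_gt0 : (0 < d)%N)
  (n r : 'I_d -> nat) (K : nat)
  (n_gt0 : forall i, (0 < n i)%N) (r_gt0 : forall j, (0 < r j)%N)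
  (K_gt0 : (0 < K)%N)
  (n_ge : forall i, (K ^ 2 <= n i)%N)
  (r_lt : forall j, (r j < K ^ 2)%N)
  (r_ge : forall j, (K <= r j)%N)
  (tau : 'S_d) (i1 i2 i3 i4 : 'I_d) (i_uniq : uniq [:: i1; i2; i3; i4]) :
  exists N : set (ring_cores R r n tau),
    ring_null N /\
    forall u : ring_cores R r n tau, ~ N u ->
    forall y : (forall i : 'I_d, 'I_(n i)),
    exists q : 4.-tuple 'I_d,
      four_index_algorithm i1 i2 i3 i4 K y (ring_tensor d_gt0 u) = Some q /\
      correct_order tau q.
Proof.
pose p := position tau.
have p_uniq : uniq [:: p i1; p i2; p i3; p i4].
  by rewrite (map_inj_uniq (@position_inj _ tau) [:: i1; i2; i3; i4]).
have u1324 : uniq [:: i1; i3; i2; i4].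
  by move: i_uniq; rewrite (perm_uniq (s2 := [:: i1; i3; i2; i4])) //;
     rewrite perm_cons (perm_catCA [:: _] [:: _]).
have u1423 : uniq [:: i1; i4; i2; i3].
  by move: i_uniq; rewrite (perm_uniq (s2 := [:: i1; i4; i2; i3])) //;
     rewrite perm_cons (perm_catC [:: _; _]).
pose M i j k l (u : ring_cores R r n tau) y :=
  mat12_34 (ring_tensor d_gt0 u) i j k l y.
have sigE i j k l u y :
    (0 < sigma_ (K ^ 4) (M i j k l u y)) = (K ^ 4 <= \rank (M i j k l u y))%N.
  by rewrite sigma_gt0 // expn_gt0 K_gt0 (expnD K 2 2) leq_mul.
have sig_lt i j k l i' j' k' l' (u : ring_cores R r n tau) :
    crossing (p i) (p j) (p k) (p l) -> uniq [:: i'; j'; k'; l'] ->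
    ~~ crossing (p i') (p j') (p k') (p l') ->
    ~ (exists y, (\rank (M i j k l u y) < K ^ 4)%N) -> forall y,
    sigma_ (K ^ 4) (M i' j' k' l' u y) < sigma_ (K ^ 4) (M i j k l u y).
  move=> cr ijkl nc h y; apply: (@le_lt_trans _ _ 0).
    by rewrite leNgt sigE -ltnNge; exact: noncrossing_rank.
  by rewrite sigE leqNgt; apply/negP => rk; apply: h; exists y.
case/or3P: (crossing_exactly_one p_uniq) => /andP[/andP[c1 c2] c3].
- exists [set u | exists y, (\rank (M i1 i2 i3 i4 u y) < K ^ 4)%N].
  split=> [|u Nu y]; first exact: crossing_generic_rank.
  exists [tuple i1; i3; i2; i4]; split; last exact: crossing_correct_order.
  rewrite /four_index_algorithm mat13_24E // mat14_23E // !gt_max.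
  by rewrite !(sig_lt i1 i2 i3 i4).
- exists [set u | exists y, (\rank (M i1 i3 i2 i4 u y) < K ^ 4)%N].
  split=> [|u Nu y]; first exact: crossing_generic_rank.
  exists [tuple i1; i2; i3; i4]; split; last exact: crossing_correct_order.
  rewrite /four_index_algorithm mat13_24E // mat14_23E // !gt_max.
  have ab := sig_lt i1 i3 i2 i4 i1 i2 i3 i4 u c2 i_uniq c1 Nu y.
  by rewrite (lt_gtF ab) ab (sig_lt i1 i3 i2 i4).
- exists [set u | exists y, (\rank (M i1 i4 i2 i3 u y) < K ^ 4)%N].
  split=> [|u Nu y]; first exact: crossing_generic_rank.
  exists [tuple i1; i2; i4; i3]; split; last exact: crossing_correct_order.
  rewrite /four_index_algorithm mat13_24E // mat14_23E // !gt_max.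
  have ac := sig_lt i1 i4 i2 i3 i1 i2 i3 i4 u c3 i_uniq c1 Nu y.
  have bc := sig_lt i1 i4 i2 i3 i1 i3 i2 i4 u c3 u1324 c2 Nu y.
  by rewrite (lt_gtF ac) (lt_gtF bc) !andbF ac bc.
Qed.
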